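(* Let $(W,S,\mathscr L)$ be a finite weighted Coxeter system. Then $\overline{\mathcal R}^{\mathscr L}$ is an invariant of its left cells: if $y,w\in W$ satisfy $y\sim_L w$ with respect to $\mathscr L$, then $\overline{\mathcal R}^{\mathscr L}(y)=\overline{\mathcal R}^{\mathscr L}(w)$.
   Context: A finite weighted Coxeter system consists of a Coxeter system $(W,S)$ with $W$ finite, length function $\ell$, and a weight function $\mathscr L:W\to\mathbb Z$, i.e. $\mathscr L(yw)=\mathscr L(y)+\mathscr L(w)$ whenever $\ell(yw)=\ell(y)+\ell(w)$; it is assumed throughout that $\mathscr L(s)>0$ for all $s\in S$. Left cells. The Iwahori--Hecke algebra $\mathcal H$ has $\mathbb Z[v,v^{-1}]$-basis $\{T_w\}$ with $T_sT_w=T_{sw}$ if $\ell(sw)>\ell(w)$ and $T_sT_w=T_{sw}+(v^{\mathscr L(s)}-v^{-\mathscr L(s)})T_w$ otherwise ($s\in S$). The Kazhdan--Lusztig basis $\{C_w\}$ is characterised by: $C_w$ is fixed by the ring involution $v\mapsto v^{-1}$, $T_w\mapsto T_{w^{-1}}^{-1}$, and $C_w\in T_w+\sum_{y<w}v^{-1}\mathbb Z[v^{-1}]T_y$ ($<$ the Bruhat order). Let $\le_L$ be the reflexive transitive closure of the relation ''there is $s\in S$ such that $C_y$ occurs with non-zero coefficient in $C_sC_w$''; $y\sim_L w$ means $y\le_L w$ and $w\le_L y$; the classes of $\sim_L$ are the left cells. Let $\overline S^{\mathscr L}$ be the union of $S$ and the set of all elements $r_k\cdots r_1\,r\,r_1\cdots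 r_k$ with $k\ge1$, $r,r_1,\dots,r_k\in S$, such that $\mathscr L(r)>k\cdot\mathscr L(r_i)$ for $1\le i\le k$, and $r_ir_{i+1}$ has order $3$ for $1\le i\le k-1$. For $w\in W$ put $\overline{\mathcal R}^{\mathscr L}(w)=\{\sigma\in\overline S^{\mathscr L}:\ell(w\sigma)<\ell(w)\}$. *)

(* Defs.v *)
From HB Require Import structures.
From mathcomp Require Import all_boot all_order all_algebra all_fingroup.
From mathcomp Require Import boolp.

Set Implicit Arguments.
Unset Strict Implicit.
Unset Printing Implicit Defensive.

Import Order.TTheory GRing.Theory Num.Theory.
Local Open Scope ring_scope.

(* Z[v, v^-1] is realised as the subring of Q(v) = Frac(Z[v]) consisting of the
   fractions p / v^n. *)
Local Notation "p %:F" := (@FracField.tofrac {poly int} p) : ring_scope.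

Definition ratv : {fraction {poly int}} := ('X : {poly int})%:F.

Definition laurent_pred : {pred {fraction {poly int}}} :=
  fun x => `[< exists p : {poly int}, exists n : nat, x = p%:F / ratv ^+ n >].

Lemma ratv_neq0 : ratv != 0.
Proof. by rewrite /ratv tofrac_eq0 polyX_eq0. Qed.

Lemma laurent_subring_closed : subring_closed laurent_pred.
Proof.
have v0 n : ratv ^+ n != 0 by rewrite expf_neq0 // ratv_neq0.
have vE n : ratv ^+ n = ('X^n : {poly int})%:F by rewrite /ratv -rmorphXn.
split.
- by apply/asboolP; exists 1, 0%N; rewrite expr0 divr1 rmorph1.
- move=> x y /asboolP[p [m ->]] /asboolP[q [n ->]]; apply/asboolP.
  exists (p * 'X^n - q * 'X^m), (m + n)%N.
  by rewrite rmorphB !rmorphM /= -!vE exprD -[X in _ + X]mulNr addf_div // mulNr.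
- move=> x y /asboolP[p [m ->]] /asboolP[q [n ->]]; apply/asboolP.
  by exists (p * q), (m + n)%N; rewrite rmorphM exprD mulf_div.
Qed.

HB.instance Definition _ :=
  GRing.isSubringClosed.Build _ laurent_pred laurent_subring_closed.

Record laurent :=
  Laurent { laurent_val : {fraction {poly int}}; _ : laurent_val \in laurent_pred }.

HB.instance Definition _ := [isSub for laurent_val].
HB.instance Definition _ := [Choice of laurent by <:].
HB.instance Definition _ := [SubChoice_isSubComNzRing of laurent by <:].

Fact vpow_subproof (n : int) : ratv ^ n \in laurent_pred.
Proof.
case: n => n; apply/asboolP.
  by exists ('X^n), 0%N; rewrite expr0 divr1 rmorphXn.
by exists 1, n.+1; rewrite rmorph1 div1r.
Qed.

Definition vpow (n : int) : laurent := Laurent (vpow_subproof n).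

Lemma vpow0 : vpow 0 = 1.
Proof. exact: val_inj. Qed.

Lemma vpowD (m n : int) : vpow (m + n) = vpow m * vpow n.
Proof. by apply: val_inj; rewrite /= expfzDr // ratv_neq0. Qed.

(* Membership in v^-1 Z[v^-1]. *)
Definition vneg (a : laurent) : Prop :=
  exists q : {poly int},
    a = \sum_(i < size q) vpow (- (i.+1)%:Z) *~ q`_i.

(* (W, S) with W = gT: the elements of S are involutions that generate W, and W
   has the presentation < S | (s t)^#[s t] = 1 > (for s = t this is s^2 = 1),
   stated as its universal property among all, possibly infinite, groups. *)
Definition coxeter_system (gT : finGroupType) (S : {set gT}) : Prop :=
  [/\ (<<S>> = [set: gT])%g,
      forall s, s \in S -> #[s]%g = 2%N
    & forall (G : groupType) (f : gT -> G),
        {in S &, forall s t, ((f s * f t) ^+ #[s * t])%g = 1%g} ->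
        exists phi : gT -> G,
          {morph phi : x y / (x * y)%g} /\ {in S, phi =1 f}].

(* (S ^+ n)%g is the set of all products of n elements of S, so this is the
   least such n; by coxlenP below a bound of #|gT| on the search suffices. *)
Definition coxlen (gT : finGroupType) (S : {set gT}) (w : gT) : nat :=
  find (fun n => w \in (S ^+ n)%g) (iota 0 #|gT|).

Lemma coxlenP (gT : finGroupType) (S : {set gT}) (w : gT) :
  (<<S>> = [set: gT])%g ->
  w \in (S ^+ coxlen S w)%g
  /\ forall n, w \in (S ^+ n)%g -> (coxlen S w <= n)%N.
Proof.
move=> genS.
pose e : rel gT := [rel x y | (x^-1 * y)%g \in S].
have pathS x p : path e x p -> (x^-1 * last x p)%g \in (S ^+ size p)%g.
  elim: p x => [|y p IHp] x /=; first by rewrite mulVg expg0 set11.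
  case/andP=> exy /IHp ylast; rewrite expgS.
  by rewrite -(mulKVg y (last y p)) mulgA mem_mulg.
have conn : connect e 1%g w.
  have [n genE] := gen_expgs S.
  have: w \in ((1 |: S) ^+ n)%g by rewrite -genE genS inE.
  elim: n w {genE} => [|n IHn] w; first by rewrite expg0 => /set1P->.
  rewrite expgSr => /mulsgP[x s /IHn xn /setU1P[->|sS] ->]; first by rewrite mulg1.
  by apply: connect_trans xn (connect1 _); rewrite /e /= mulKg.
have [n ltn wn] : exists2 n, (n < #|gT|)%N & w \in (S ^+ n)%g.
  have [p pP ->] := connectP conn; have [p' p'P up' _] := shortenP pP.
  exists (size p'); last by have := pathS _ _ p'P; rewrite invg1 mul1g.
  by have := max_card [in 1%g :: p']; rewrite (card_uniqP up').
have hasn : has (fun n => w \in (S ^+ n)%g) (iota 0 #|gT|).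
  by apply/hasP; exists n; rewrite // mem_iota.
have lt_len : (coxlen S w < #|gT|)%N.
  by move: hasn; rewrite has_find size_iota.
split; first by have := nth_find 0%N hasn; rewrite nth_iota.
move=> m wm; rewrite leqNgt; apply/negP=> ltm.
have := before_find 0%N ltm; rewrite nth_iota ?wm //.
exact: ltn_trans ltm lt_len.
Qed.

Definition weight_function (gT : finGroupType) (S : {set gT}) (L : gT -> int) :
    Prop :=
  forall y w : gT,
    coxlen S (y * w)%g = (coxlen S y + coxlen S w)%N ->
    L (y * w)%g = L y + L w.

Definition reflections (gT : finGroupType) (S : {set gT}) : {set gT} :=
  class_support S [set: gT].

Definition bruhat_lt (gT : finGroupType) (S : {set gT}) : rel gT :=
  [rel y w | (y != w) &&
     connect [rel x z | ((x^-1 * z)%g \in reflections S)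
                        && (coxlen S x < coxlen S z)%N] y w].

(* H, with the family T, is the Iwahori-Hecke algebra of (W, S, L); this
   determines (H, T) up to a unique isomorphism.  The condition T 1 = 1 follows
   from the others unless S is empty. *)
Record hecke_algebra (gT : finGroupType) (S : {set gT}) (L : gT -> int)
    (H : algType laurent) (T : gT -> H) : Prop := HeckeAlgebra {
  hecke_basis : forall h : H,
    exists! a : {ffun gT -> laurent}, h = \sum_(w : gT) a w *: T w;
  hecke_one : T 1%g = 1;
  hecke_mul : forall s w : gT, s \in S ->
    T s * T w =
      if (coxlen S w < coxlen S (s * w)%g)%N then T (s * w)%g
      else T (s * w)%g + (vpow (L s) - vpow (- L s)) *: T w }.

(* T_w |-> T_{w^-1}^-1, with the inverse stated by its two equations since an
   algType has no inverse operation. *)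
Record bar_involution (gT : finGroupType) (H : algType laurent) (T : gT -> H)
    (bar : {rmorphism H -> H}) : Prop := BarInvolution {
  barK : involutive bar;
  bar_vpow : forall n : int, bar (vpow n *: 1) = vpow (- n) *: 1;
  bar_T : forall w : gT,
    bar (T w) * T (w^-1)%g = 1 /\ T (w^-1)%g * bar (T w) = 1 }.

Definition kl_basis (gT : finGroupType) (S : {set gT}) (H : algType laurent)
    (T : gT -> H) (bar : {rmorphism H -> H}) (C : gT -> H) : Prop :=
  forall w : gT,
    bar (C w) = C w
    /\ exists2 p : gT -> laurent, (forall y, vneg (p y)) &
         C w = T w + \sum_(y : gT | bruhat_lt S y w) p y *: T y.

Definition left_step (gT : finGroupType) (S : {set gT}) (H : algType laurent)
    (C : gT -> H) (y w : gT) : Prop :=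
  exists2 s, s \in S &
    exists2 c : gT -> laurent, C s * C w = \sum_(z : gT) c z *: C z & c y != 0.

Definition left_le (gT : finGroupType) (S : {set gT}) (H : algType laurent)
    (C : gT -> H) : rel gT :=
  connect [rel y w | `[< left_step S C y w >]].

Definition left_sim (gT : finGroupType) (S : {set gT}) (H : algType laurent)
    (C : gT -> H) : rel gT :=
  [rel y w | left_le S C y w && left_le S C w y].

Definition ext_reflection (gT : finGroupType) (S : {set gT}) (L : gT -> int)
    (sigma : gT) : Prop :=
  exists (r : gT) (rs : seq gT),
    [/\ (0 < size rs)%N, r \in S, {subset rs <= S},
        {in rs, forall ri, L r > (size rs)%:Z * L ri}
      & sorted [rel a b | #[a * b]%g == 3%N] rs]
    /\ sigma = (\prod_(x <- rev rs) x * r * \prod_(x <- rs) x)%g.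

Definition ext_gens (gT : finGroupType) (S : {set gT}) (L : gT -> int) :
    {set gT} :=
  S :|: [set sigma | `[< ext_reflection S L sigma >]].

Definition ext_right_descents (gT : finGroupType) (S : {set gT})
    (L : gT -> int) (w : gT) : {set gT} :=
  [set sigma in ext_gens S L | (coxlen S (w * sigma)%g < coxlen S w)%N].

(* Main.v *)
Require Import Defs.
From mathcomp Require Import all_boot all_order all_algebra all_fingroup.
From mathcomp Require Import boolp zify.
Import Order.TTheory GRing.Theory Num.Theory.

Set Implicit Arguments.
Unset Strict Implicit.
Unset Printing Implicit Defensive.

Local Open Scope ring_scope.

(* Let C_s' := T_s + v^(-L s).  Call a set U of group elements admissible of
   level c if {C_u : u in U} spans a left ideal M and, for u in U and z not in
   U, the coefficient of T_z in C_u lies in v^(-c) Z[v^-1].  If L s < c, then a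
   degree argument together with invariance under the bar involution shows that
   C_u C_s' = C_us modulo M when us is not in U, and C_u C_s' is in M otherwise.
   Hence M + M C_s' and {h in M | h C_s' in M} are left ideals spanned by the C_w
   with w in U :|: U s and in U :&: U s, and both sets are admissible of level
   c - L s.  The starting point is U = {w | w r < w}, of level L r.

   An admissible set is closed downwards for the left preorder, so elements y
   and w of one left cell agree on U, on U :|: U s and on U :&: U s; since they
   agree on U, one of the other two sets forces y s and w s to agree on U.  By
   induction y r_k .. r_1 and w r_k .. r_1 agree on {w | w r < w} as soon as
   L r_1 + .. + L r_k < L r.  With d = r_k .. r_1, the same inequality gives
   d r > d, and then w has sigma = d r d^-1 as a right descent exactly when w d
   has r as one. *)

(** * Laurent polynomials and their degree in [v] *)

Definition leval (x : laurent) (p : {poly int}) : laurent := (map_poly intr p).[x].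

Lemma leval0 x : leval x 0 = 0.
Proof. by rewrite /leval rmorph0 horner0. Qed.

Lemma leval1 x : leval x 1 = 1.
Proof. by rewrite /leval rmorph1 hornerC. Qed.

Lemma levalD x p q : leval x (p + q) = leval x p + leval x q.
Proof. by rewrite /leval rmorphD hornerD. Qed.

Lemma levalM x p q : leval x (p * q) = leval x p * leval x q.
Proof. by rewrite /leval rmorphM hornerM. Qed.

Lemma levalN x p : leval x (- p) = - leval x p.
Proof. by rewrite /leval rmorphN hornerN. Qed.

Lemma levalC x c : leval x c%:P = c%:~R.
Proof. by rewrite /leval map_polyC hornerC. Qed.

Lemma levalX x : leval x 'X = x.
Proof. by rewrite /leval map_polyX hornerX. Qed.

Lemma levalXn x n : leval x 'X^n = x ^+ n.
Proof. by rewrite /leval map_polyXn hornerXn. Qed.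

Lemma vpowXn (d : int) n : vpow d ^+ n = vpow (d * n%:Z).
Proof.
elim: n => [|n IHn]; first by rewrite expr0 mulr0 vpow0.
by rewrite exprS IHn -vpowD; congr vpow; lia.
Qed.

Lemma val_leval p : val (leval (vpow 1) p) = FracField.tofrac p.
Proof.
elim/poly_ind: p => [|p c IHp].
  by rewrite leval0 !rmorph0.
rewrite levalD levalM levalX levalC !rmorphD !rmorphM /= IHp; congr (_ + _).
have -> : c%:P = (c%:~R : {poly int}) by rewrite -[c in LHS]intz rmorph_int.
rewrite rmorph_int.
exact: (rmorph_int (val : {rmorphism laurent -> {fraction {poly int}}})).
Qed.

Lemma leval_inj : injective (leval (vpow 1)).
Proof.
move=> p q /(congr1 val); rewrite !val_leval => /eqP.
by rewrite tofrac_eq => /eqP.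
Qed.

Lemma leval_val_ex (a : laurent) : exists n p, vpow n%:Z * a = leval (vpow 1) p.
Proof.
case: a => x xP; have /asboolP[p [n Ex]] := xP; exists n, p; apply: val_inj.
rewrite val_leval rmorphM /= Ex mulrC divfK // expf_neq0 //; exact: ratv_neq0.
Qed.

(** Coefficient reversal: [size p] exceeds the degree of a nonzero [p] by one, which leaves the
    extra factor [v] on the right. *)
Lemma leval_rev (p : {poly int}) : exists2 q : {poly int}, (size q <= size p)%N
  & vpow (size p)%:Z * leval (vpow (-1)) p = vpow 1 * leval (vpow 1) q.
Proof.
elim/poly_ind: p => [|p c [q sq Eq]].
  by exists 0 => //; rewrite !leval0 !mulr0.
have [->|nz] := eqVneq (p * 'X + c%:P) 0.
  by exists 0 => //; rewrite !leval0 !mulr0.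
have sE : size (p * 'X + c%:P) = (size p).+1.
  rewrite size_MXaddC; case: ifP => // /andP[/eqP p0 /eqP c0].
  by rewrite p0 c0 mul0r addr0 eqxx in nz.
exists (q + c *: 'X^(size p)).
  rewrite sE (leq_trans (size_polyD _ _)) // geq_max (leq_trans sq) //=.
  by rewrite (leq_trans (size_scale_leq _ _)) // size_polyXn.
rewrite sE -mul_polyC !levalD !levalM !levalX !levalC levalXn !mulrDr vpowXn.
rewrite -Eq; congr (_ + _).
  rewrite mulrA mulrAC -vpowD; congr (vpow _ * _); lia.
rewrite mulrCA -vpowD [RHS]mulrC; congr (vpow _ * _); lia.
Qed.

(** Degree in [v] at most [d]. Phrased through a polynomial in [v^-1], it covers zero without a
    convention and is stable under sums and products. *)
Definition ldeg (d : int) (a : laurent) : Prop :=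
  exists p : {poly int}, a = vpow d * leval (vpow (-1)) p.

Lemma ldeg0 d : ldeg d 0.
Proof. by exists 0; rewrite leval0 mulr0. Qed.

Lemma ldeg_vpow d : ldeg d (vpow d).
Proof. by exists 1; rewrite leval1 mulr1. Qed.

Lemma ldeg1 : ldeg 0 1.
Proof. by rewrite -vpow0; apply: ldeg_vpow. Qed.

Lemma ldegD d a b : ldeg d a -> ldeg d b -> ldeg d (a + b).
Proof. by move=> [p ->] [q ->]; exists (p + q); rewrite levalD mulrDr. Qed.

Lemma ldegN d a : ldeg d a -> ldeg d (- a).
Proof. by move=> [p ->]; exists (- p); rewrite levalN mulrN. Qed.

Lemma ldegB d a b : ldeg d a -> ldeg d b -> ldeg d (a - b).
Proof. by move=> da /ldegN; apply: ldegD. Qed.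

Lemma ldegM d e a b : ldeg d a -> ldeg e b -> ldeg (d + e) (a * b).
Proof. by move=> [p ->] [q ->]; exists (p * q); rewrite levalM vpowD mulrACA. Qed.

Lemma ldegW d e a : (d <= e)%R -> ldeg d a -> ldeg e a.
Proof.
move=> led [p ->]; exists ('X^`|e - d| * p).
rewrite levalM levalXn vpowXn mulrA -vpowD; congr (vpow _ * _); lia.
Qed.

Lemma ldeg_sum (I : Type) (r : seq I) (P : pred I) (F : I -> laurent) d :
  (forall i, P i -> ldeg d (F i)) -> ldeg d (\sum_(i <- r | P i) F i).
Proof. by move=> dF; apply: big_ind => //; [apply: ldeg0 | apply: ldegD]. Qed.

Lemma vneg_ldeg a : vneg a -> ldeg (-1) a.
Proof.
move=> [q ->]; apply: ldeg_sum => i _; exists (q`_i *: 'X^i).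
rewrite -mul_polyC levalM levalC levalXn vpowXn mulrCA -vpowD mulrzl.
by congr (vpow _ *~ _); lia.
Qed.

Lemma ldeg_ex a : exists d, ldeg d a.
Proof.
have [n [p Ea]] := leval_val_ex a.
have -> : a = vpow (- n%:Z) * leval (vpow 1) p.
  by rewrite -Ea mulrA -vpowD addNr vpow0 mul1r.
suff [d dp] : exists d, ldeg d (leval (vpow 1) p).
  by exists (- n%:Z + d); apply: ldegM => //; apply: ldeg_vpow.
exists (size p)%:Z; rewrite /leval horner_coef; apply: ldeg_sum => i _.
rewrite vpowXn coef_map /= mul1r.
apply: ldegW (_ : ldeg (0 + i%:Z) _).
  rewrite add0r lez_nat ltnW // (leq_trans (ltn_ord i)) //; exact: size_poly.
apply: ldegM; last exact: ldeg_vpow.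
by exists (p`_i)%:P; rewrite levalC vpow0 mul1r.
Qed.

(** One side has only negative powers of [v], the other only positive ones. Reversal turns this into
    a clash of sizes: [q] has size at most [size p], yet equals ['X^((size p).+1) * p]. *)
Lemma ldeg_sym0 p :
  vpow (-1) * leval (vpow (-1)) p = vpow 1 * leval (vpow 1) p -> p = 0.
Proof.
move=> Ep; have [q sq Eq] := leval_rev p.
have : leval (vpow 1) q = leval (vpow 1) ('X^((size p).+1) * p).
  have : vpow (-1) * (vpow 1 * leval (vpow 1) q)
         = vpow (-1) * (vpow 1 * leval (vpow 1) ('X^((size p).+1) * p)).
    rewrite -Eq mulrCA Ep levalM levalXn vpowXn !mulrA -!vpowD.
    by congr (vpow _ * _); lia.
  by rewrite !mulrA -vpowD addNr vpow0 !mul1r.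
move/leval_inj => Eqp; apply/eqP; apply: contraT => nzp.
move: sq; rewrite Eqp mulrC size_Mmonic ?monicXn // size_polyXn.
by have := polySpred nzp; lia.
Qed.

(** Averaging: every term lies below [b] divided by the number of terms. *)
Lemma sum_lt_size (I : eqType) (r : seq I) (F : I -> int) (b : int) :
  (0 < size r)%N -> {in r, forall i, (size r)%:Z * F i < b} -> \sum_(i <- r) F i < b.
Proof.
move=> r0 Fb; rewrite -(ltr_pM2l (_ : 0 < (size r)%:Z)) ?ltz_nat // mulr_sumr.
have -> : (size r)%:Z * b = \sum_(i <- r) b.
  by rewrite big_const_seq count_predT iter_addr_0 -natz mulr_natl.
rewrite big_seq [ltRHS]big_seq; apply: ltr_sum => //.
by apply/hasP; case: r r0 {Fb} => // i r _; exists i; rewrite mem_head.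
Qed.

(** * Inversions and strong exchange in a Coxeter group *)

Section Coxeter.
Local Open Scope group_scope.
Variables (gT : finGroupType) (S : {set gT}).
Hypothesis hW : coxeter_system S.
Local Notation len := (coxlen S).

Let genS : <<S>> = [set: gT]. Proof. by case: hW. Qed.

Lemma coxgen_sqr s : s \in S -> s * s = 1.
Proof. by case: hW => _ oS _ /oS os; have := expg_order s; rewrite os. Qed.

Lemma coxgenV s : s \in S -> s^-1 = s.
Proof. by move=> sS; apply: (mulgI s); rewrite mulgV coxgen_sqr. Qed.

Lemma coxlen_mem w : w \in S ^+ len w.
Proof. by case: (coxlenP w genS). Qed.

Lemma coxlen_le w n : w \in S ^+ n -> (len w <= n)%N.
Proof. by case: (coxlenP w genS) => _; apply. Qed.

Lemma coxlen1 : len 1 = 0%N.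
Proof. by apply/eqP; rewrite -leqn0; apply: coxlen_le; rewrite expg0 set11. Qed.

Lemma coxlen_eq0 w : len w = 0%N -> w = 1.
Proof. by move=> w0; have := coxlen_mem w; rewrite w0 expg0 => /set1P. Qed.

Lemma coxlenV w : len w^-1 = len w.
Proof.
have memV n x : x \in S ^+ n -> x^-1 \in S ^+ n.
  elim: n x => [|n IHn] x; first by rewrite expg0 => /set1P->; rewrite invg1 set11.
  rewrite expgS => /mulsgP[s y sS /IHn yn ->].
  by rewrite invMg -expgS expgSr mem_mulg // coxgenV.
have leV x : (len x^-1 <= len x)%N by apply: coxlen_le; apply/memV/coxlen_mem.
by apply/eqP; rewrite eqn_leq leV -{1}[w]invgK leV.
Qed.

(** The sign-twisted conjugation action behind the exchange condition, taken on all of [gT * bool]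
    rather than on reflections so that it lands in a plain permutation group. *)
Definition reflection_fun (s : gT) (u : gT * bool) := (u.1 ^ s, u.2 (+) (u.1 == s)).

Lemma reflection_fun_inj s : injective (reflection_fun s).
Proof.
by move=> [x e] [y f] [/conjg_inj-> /addIb->].
Qed.

Definition reflection_perm s : {perm gT * bool} := perm (@reflection_fun_inj s).

Lemma reflection_permE s x (e : bool) : reflection_perm s (x, e) = (x ^ s, e (+) (x == s)).
Proof. by rewrite permE. Qed.

(** Each of the [m.*2] letters flips the sign at one element; pulled back to the start, these are
    reflections in the dihedral group of [s] and [t]. *)
Lemma reflection_perm_exp s t m x (e : bool) : s \in S -> t \in S ->
  ((reflection_perm s * reflection_perm t) ^+ m) (x, e) =
  (x ^ ((s * t) ^+ m), e (+) \big[addb/false]_(0 <= k < m.*2) (x == (s * t) ^+ k * s)).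
Proof.
move=> sS tS; set g := s * t.
have sg : s * g^-1 = g * s by rewrite invMg !coxgenV // mulgA.
have sE n : s * g ^- n = g ^+ n * s.
  elim: n => [|n IHn]; first by rewrite expg0 invg1 mulg1 mul1g.
  by rewrite expgS invMg mulgA IHn -mulgA sg mulgA -expgSr -expgS.
have conjE (u h : gT) : (x ^ h == u) = (x == h * u * h^-1).
  apply/eqP/eqP => [<-|->]; first by rewrite conjgE mulKVg mulgK.
  by rewrite conjgE mulgKV mulKg.
elim: m => [|m IHm].
  by rewrite !expg0 perm1 conjg1 big_geq // addbF.
rewrite expgSr permM IHm permM !reflection_permE doubleS !big_nat_recr //=.
rewrite -!conjgM -!addbA -[s * t]/g -expgSr.
congr (_, _ (+) (_ (+) (_ (+) _))); rewrite conjE.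
  by rewrite -mulgA sE mulgA -expgD addnn.
by rewrite invMg coxgenV // sE mulgA -(mulgA _ s t) -/g -expgSr -expgD addSn addnn.
Qed.

(* [n w] is the indicator of the left inversions of [w] among the reflections. *)
Lemma inversion_cocycle : exists n : gT -> gT -> bool,
  [/\ forall u v x, n (u * v) x = n u x (+) n v (x ^ u)
    & forall s x, s \in S -> n s x = (x == s)].
Proof.
have [_ _ univ] := hW.
have rel : {in S &, forall s t,
    (reflection_perm s * reflection_perm t) ^+ #[s * t] = 1}.
  move=> s t sS tS; apply/permP => -[x e].
  rewrite reflection_perm_exp // perm1 expg_order conjg1 -addnn.
  (* With [m] the order of [s * t], the second half of the product repeats the first, so the sign
     flips cancel. *)
  rewrite (big_cat_nat (n := #[s * t])) ?leq_addr //= -{2}[#[s * t]]add0n big_addn addnK.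
  under [in X in _ (+) (_ (+) X)]eq_bigr => k _ do rewrite expgD expg_order mulg1.
  by rewrite addbb addbF.
have [phi [phiM phiS]] := univ _ _ rel.
pose n w x : bool := (phi w (x, false)).2.
have phi1 : phi 1 = 1 by apply: (mulgI (phi 1)); rewrite -phiM !mulg1.
have phiE w x (e : bool) : phi w (x, e) = (x ^ w, e (+) n w x).
  move: (coxlen_mem w) x e; move: (len w) => k.
  elim: k w => [|k IHk] w.
    by rewrite expg0 => /set1P-> x e; rewrite /n phi1 !perm1 conjg1 addbF.
  rewrite expgS => /mulsgP[s v sS vk ->] x e.
  rewrite /n phiM !permM (phiS s) // !reflection_permE !IHk //= conjgM.
  by rewrite addbA.
exists n; split=> [u v x|s x sS].
  by rewrite {1}/n phiM permM (phiE u) phiE.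
by rewrite /n phiS // reflection_permE.
Qed.

(** Strong exchange: an inversion of a word deletes one of its letters, and a reflection [x] is an
    inversion of exactly one of [w] and [x * w]. *)
Lemma coxlen_inversion (n : gT -> gT -> bool) :
    (forall u v x, n (u * v) x = n u x (+) n v (x ^ u)) ->
    (forall s x, s \in S -> n s x = (x == s)) ->
  forall r w g, r \in S ->
    len (r ^ g * w) != len w /\ (len (r ^ g * w) < len w)%N = n w (r ^ g).
Proof.
move=> nM nS r w g rS; set x := r ^ g.
(* Letters are peeled off the left: a letter equal to [y] is deleted; past any other letter [s], [y]
   becomes [y ^ s]. *)
have shorten k u y : u \in S ^+ k -> n u y -> (0 < k)%N /\ y * u \in S ^+ k.-1.
  elim: k u y => [|k IHk] u y.
    rewrite expg0 => /set1P-> n1; have := nM 1 1 y.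
    by rewrite mulg1 conjg1 addbb n1.
  rewrite expgS => /mulsgP[s v sS vk ->]; rewrite nM nS //.
  have [->|ys] /= := eqVneq y s; first by rewrite mulgA coxgen_sqr // mul1g.
  case/(IHk v _ vk) => k0; rewrite -(prednK k0) expgS => vS; split=> //.
  have -> : y * (s * v) = s * (y ^ s * v) by rewrite conjgE coxgenV // !mulgA coxgen_sqr // mul1g.
  exact: mem_mulg.
have n1 y : n 1 y = false by have := nM 1 1 y; rewrite mulg1 conjg1; case: (n 1 y).
have cxx (y : gT) : y ^ y = y by rewrite conjgE mulKg.
(* In [x = g^-1 * r * g] the contributions of [g^-1] and [g] cancel, and that of the middle [r]
   remains. *)
have nxx : n x x.
  have := nM g g^-1 r; rewrite mulgV n1 -/x => ng.
  rewrite {1}/x conjgE !nM (nS r) // (_ : x ^ g^-1 = r) ?conjgK // cxx eqxx.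
  by move: ng; case: (n g r); case: (n _ x).
have lt_x u : n u x -> (len (x * u) < len u)%N.
  move=> /(shorten _ _ _ (coxlen_mem u))[u0 /coxlen_le].
  by move=> /leq_ltn_trans; apply; rewrite prednK.
have xx : x * x = 1 by rewrite -conjMg coxgen_sqr // conj1g.
case nwx: (n w x); first by have := lt_x w nwx => lt; split=> //; rewrite neq_ltn lt.
have /lt_x : n (x * w) x by rewrite nM nxx cxx nwx.
rewrite mulgA xx mul1g => lt; split; first by rewrite neq_ltn lt orbT.
by apply/negbTE; rewrite -leqNgt ltnW.
Qed.

Lemma coxlen_mulS_neq w s : s \in S -> len (w * s) != len w.
Proof.
move=> sS; have [n [nM nS]] := inversion_cocycle.
have [ne _] := coxlen_inversion nM nS (w^-1) 1 sS.
by rewrite conjg1 -coxlenV invMg invgK coxgenV // coxlenV in ne.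
Qed.

Lemma coxlen_mulS_le w s : s \in S -> (len (w * s) <= (len w).+1)%N.
Proof. by move=> sS; apply: coxlen_le; rewrite expgSr mem_mulg // coxlen_mem. Qed.

Lemma coxlen_mulSS w s : s \in S -> w * s * s = w.
Proof. by move=> sS; rewrite -mulgA coxgen_sqr // mulg1. Qed.

Lemma coxlen_gt w s : s \in S -> (len w < len (w * s))%N -> len (w * s) = (len w).+1.
Proof. by move=> sS lt; apply/eqP; rewrite eqn_leq lt coxlen_mulS_le. Qed.

Lemma coxlen_ngt w s : s \in S -> ~~ (len w < len (w * s))%N -> len w = (len (w * s)).+1.
Proof.
move=> sS; rewrite -leqNgt => ge; apply/eqP; rewrite eqn_leq ltn_neqAle.
rewrite coxlen_mulS_neq // ge -{1}(coxlen_mulSS w sS).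
by rewrite coxlen_mulS_le.
Qed.

Lemma coxlen_gen s : s \in S -> len s = 1%N.
Proof.
move=> sS; have := coxlen_mulS_le 1 sS; have := coxlen_mulS_neq 1 sS.
by rewrite mul1g coxlen1; case: (len s) => [|[]].
Qed.

(** The cocycle at [d^-1 * w^-1] and [r] splits into the term of [d^-1] at [r], which is false as
    [r] is no descent of [d], and that of [w^-1] at [d * r * d^-1]. *)
Lemma coxlen_conj r d w : r \in S -> ~~ (len (d * r) < len d)%N ->
  (len (w * (d * r * d^-1)) < len w)%N = (len (w * d * r) < len (w * d))%N.
Proof.
move=> rS; have [n [nM nS]] := inversion_cocycle.
have E g u : (len (u * r ^ g) < len u)%N = n u^-1 (r ^ g).
  have [_ <-] := coxlen_inversion nM nS u^-1 g rS.
  by rewrite coxlenV -(coxlenV (_ * u^-1)) invMg invgK -conjVg coxgenV.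
have := E 1; rewrite conjg1 => E1.
rewrite !E1 => nd; have -> : d * r * d^-1 = r ^ d^-1 by rewrite conjgE invgK mulgA.
by rewrite E invMg nM (negPf nd).
Qed.

(** * Weights of words and descents *)

Section Weight.
Variable L : gT -> int.
Hypotheses (hL : weight_function S L) (hLpos : forall s : gT, s \in S -> (0 < L s)%R).

Lemma weight1 : L 1 = 0%R.
Proof. by have := @hL 1 1; rewrite mulg1 coxlen1 => /(_ erefl); lia. Qed.

Lemma weight_gt w s : s \in S -> (len w < len (w * s))%N -> L (w * s) = (L w + L s)%R.
Proof. by move=> sS lt; apply: hL; rewrite (coxlen_gt sS lt) (coxlen_gen sS) addn1. Qed.

Lemma weight_ngt w s : s \in S -> ~~ (len w < len (w * s))%N -> L w = (L (w * s) + L s)%R.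
Proof.
move=> sS ge; have := coxlen_ngt sS ge => E.
have lt : (len (w * s) < len (w * s * s))%N by rewrite coxlen_mulSS // E.
by rewrite -(weight_gt sS lt) coxlen_mulSS.
Qed.

Lemma weight_ge0 w : (0 <= L w)%R.
Proof.
have [k] := ubnP (len w); elim: k w => // k IHk w lw.
have := coxlen_mem w; case E: (len w) => [|l].
  by rewrite (coxlen_eq0 E) weight1.
rewrite expgSr => /mulsgP[u s ul sS Ew].
have lu : (len u < len (u * s))%N by rewrite -Ew E ltnS coxlen_le.
rewrite Ew weight_gt //; apply: addr_ge0; last exact/ltW/hLpos.
by apply: IHk; apply: leq_trans lu _; rewrite -Ew -ltnS.
Qed.

Lemma weight_prod_le (rs : seq gT) : {subset rs <= S} ->
  (L (\prod_(x <- rs) x) <= \sum_(x <- rs) L x)%R.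
Proof.
elim/last_ind: rs => [|rs s IHrs] rsS; first by rewrite !big_nil weight1.
have sS : s \in S by apply: rsS; rewrite mem_rcons mem_head.
rewrite !big_rcons /=; set u := \prod_(x <- rs) x.
have {}IHrs : (L u <= \sum_(x <- rs) L x)%R.
  by apply: IHrs => x xrs; apply: rsS; rewrite mem_rcons inE xrs orbT.
have [lt|ge] := boolP (len u < len (u * s))%N; first by rewrite weight_gt // lerD2r.
have s0 := ltW (hLpos sS); apply: (@le_trans _ _ (L u + L s)%R); last by rewrite lerD2r.
by rewrite (weight_ngt sS ge) -addrA lerDl addr_ge0.
Qed.

(** If [r] were a descent of the product [d], then [L d = L (d * r) + L r] would be at least [L r],
    against [weight_prod_le]. *)
Lemma weight_lt_ndescent (rs : seq gT) r : {subset rs <= S} -> r \in S ->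
  (\sum_(x <- rs) L x < L r)%R ->
  ~~ (len (\prod_(x <- rs) x * r) < len (\prod_(x <- rs) x))%N.
Proof.
move=> rsS rS; have := weight_prod_le rsS; set d := \prod_(x <- rs) x => dle lt.
apply/negP => lt_len; have := weight_ngt rS (_ : ~~ (len d < len (d * r))%N).
rewrite -leqNgt ltnW // => /(_ isT) Ed.
by have := le_lt_trans dle lt; rewrite Ed gtrDr ltNge weight_ge0.

Qed.

End Weight.

End Coxeter.

(** * Right multiplication in the Hecke algebra *)

Section Hecke.
Variables (gT : finGroupType) (S : {set gT}) (L : gT -> int).
Hypotheses (hW : coxeter_system S) (hLpos : forall s : gT, s \in S -> 0 < L s).
Variables (H : algType laurent) (T : gT -> H).
Hypothesis hH : hecke_algebra S L T.
Local Notation len := (coxlen S).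

Definition tcoef (h : H) : gT -> laurent := projT1 (cid (hecke_basis hH h)).

Lemma tcoef_sum h : h = \sum_w tcoef h w *: T w.
Proof. by rewrite /tcoef; case: cid => a []. Qed.

Lemma tcoef_uniq h (a : gT -> laurent) : h = \sum_w a w *: T w -> tcoef h =1 a.
Proof.
move=> Eh; rewrite /tcoef; case: cid => b [_ /=] /(_ [ffun w => a w]) buniq w.
rewrite buniq ?ffunE // Eh; apply: eq_bigr => z _; by rewrite ffunE.
Qed.

Lemma tcoefD g h z : tcoef (g + h) z = tcoef g z + tcoef h z.
Proof.
apply: (tcoef_uniq (a := fun z => tcoef g z + tcoef h z)).
rewrite [in LHS](tcoef_sum g) [in LHS](tcoef_sum h) -big_split /=.
by apply: eq_bigr => w _; rewrite scalerDl.
Qed.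

Lemma tcoefZ a h z : tcoef (a *: h) z = a * tcoef h z.
Proof.
apply: (tcoef_uniq (a := fun z => a * tcoef h z)).
rewrite [in LHS](tcoef_sum h) scaler_sumr.
by apply: eq_bigr => w _; rewrite scalerA.
Qed.

Lemma tcoefB g h z : tcoef (g - h) z = tcoef g z - tcoef h z.
Proof. by rewrite -scaleN1r tcoefD tcoefZ mulN1r. Qed.

Lemma tcoef0 z : tcoef 0 z = 0.
Proof. by rewrite -(scale0r 0) tcoefZ mul0r. Qed.

Lemma tcoef_bigsum (I : Type) (r : seq I) (P : pred I) (F : I -> H) z :
  tcoef (\sum_(i <- r | P i) F i) z = \sum_(i <- r | P i) tcoef (F i) z.
Proof.
by apply: (big_morph (fun h => tcoef h z)) => [g h|]; [apply: tcoefD|apply: tcoef0].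
Qed.

Lemma tcoefT w z : tcoef (T w) z = (z == w)%:R.
Proof.
apply: (tcoef_uniq (a := fun z => (z == w)%:R)).
rewrite (bigD1 w) //= eqxx scale1r big1 ?addr0 // => u /negPf->; exact: scale0r.
Qed.

(** The defining relations multiply on the left. Peeling a first letter [t] off [w] carries the rule
    to the right by associativity; length counts show that every product involved is
    length-additive. *)
Lemma hecke_mulr_gt w s : s \in S -> (len w < len (w * s)%g)%N ->
  T w * T s = T (w * s)%g.
Proof.
move=> sS; have [k] := ubnP (len w); elim: k w => // k IHk w lw lt.
have := coxlen_mem hW w; case E: (len w) => [|l].
  by rewrite (coxlen_eq0 hW E) (hecke_one hH) !mul1g mul1r.
rewrite expgS => /mulsgP[t u tS ul Ew].
have lu : (len u <= l)%N by apply: coxlen_le.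
have left_le x : (len (t * x)%g <= (len x).+1)%N.
  by apply: coxlen_le => //; rewrite expgS mem_mulg // coxlen_mem.
have ltu : (len u < len (t * u)%g)%N by rewrite -Ew E ltnS.
have luE : len u = l by have := left_le u; rewrite -Ew E; lia.
have := left_le (u * s)%g; have lt1 := coxlen_gt hW sS lt.
rewrite mulgA -Ew lt1 ltnS E => ltus.
have Tw : T w = T t * T u by rewrite (hecke_mul hH) // ltu -Ew.
have ltus' : (len u < len (u * s)%g)%N by rewrite luE.
have Eus : len (u * s)%g = l.+1 by rewrite (coxlen_gt hW sS ltus') luE.
rewrite Tw -mulrA IHk //; last by rewrite luE -ltnS -E.
rewrite (hecke_mul hH) //; rewrite mulgA -Ew lt1 E Eus ltnSn.
by [].
Qed.

Definition qpar s := vpow (L s) - vpow (- L s).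

Lemma hecke_sqr s : s \in S -> T s * T s = 1 + qpar s *: T s.
Proof.
move=> sS; rewrite (hecke_mul hH) // (coxgen_sqr hW) //.
by rewrite (coxlen1 hW) ltn0 (hecke_one hH).
Qed.

Lemma hecke_mulr w s : s \in S ->
  T w * T s = T (w * s)%g + (if (len w < len (w * s)%g)%N then 0 else qpar s) *: T w.
Proof.
move=> sS; case: ifP => [lt|/negbT ge].
  by rewrite scale0r addr0 hecke_mulr_gt.
have lt : (len (w * s)%g < len (w * s * s)%g)%N.
  by rewrite (coxlen_mulSS hW) // [ltnRHS](coxlen_ngt hW sS ge).
have Tw : T w = T (w * s)%g * T s by rewrite hecke_mulr_gt // (coxlen_mulSS hW).
rewrite {1}Tw -mulrA hecke_sqr // mulrDr mulr1; congr (_ + _).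
by rewrite -scalerAr -Tw.
Qed.

Lemma tcoef_mulT h s z : s \in S ->
  tcoef (h * T s) z =
  tcoef h (z * s)%g + (if (len z < len (z * s)%g)%N then 0 else qpar s) * tcoef h z.
Proof.
move=> sS; rewrite {1}(tcoef_sum h) mulr_suml tcoef_bigsum.
under eq_bigr => w _ do
  rewrite -scalerAl hecke_mulr // tcoefZ tcoefD tcoefZ !tcoefT mulrDr.
rewrite big_split /=; congr (_ + _).
  rewrite (bigD1 (z * s)%g) //= (coxlen_mulSS hW) // eqxx mulr1 big1 ?addr0 // => w ne.
  case: eqP => [Ez|_]; last by rewrite mulr0.
  by rewrite Ez (coxlen_mulSS hW) // eqxx in ne.
rewrite (bigD1 z) //= eqxx mulr1 mulrC big1 ?addr0 // => w.
by rewrite eq_sym => /negPf->; rewrite !mulr0.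
Qed.

Definition klgen s : H := T s + vpow (- L s) *: 1.

Lemma tcoef_mul_klgen h s z : s \in S ->
  tcoef (h * klgen s) z = tcoef h (z * s)%g +
    vpow (if (len z < len (z * s)%g)%N then - L s else L s) * tcoef h z.
Proof.
move=> sS; rewrite mulrDr -scalerAr mulr1 tcoefD tcoefZ tcoef_mulT // -addrA.
by congr (_ + _); rewrite -mulrDl; case: ifP; rewrite ?add0r // subrK.
Qed.

Lemma tcoef_klgen_deg h s z : s \in S -> (forall y, ldeg 0 (tcoef h y)) ->
  ldeg (L s) (tcoef (h * klgen s) z).
Proof.
move=> sS h0; rewrite tcoef_mul_klgen //; have := hLpos sS => Ls.
apply: ldegD; first by apply: ldegW (h0 _); exact: ltW.
apply: (@ldegW (L s + 0)); [by rewrite addr0 | apply: ldegM => //].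
case: ifP => _; last exact: ldeg_vpow.
by apply: ldegW (ldeg_vpow _); lia.
Qed.

(** * The bar involution on coefficients *)

Section Bar.
Variable bar : {rmorphism H -> H}.
Hypothesis hbar : bar_involution T bar.

(** The involution is given on [H]; its effect on scalars is read off from multiples of [1]. *)
Definition barc (a : laurent) : laurent := tcoef (bar (a *: 1)) 1%g.

Lemma tcoefA a : tcoef (a *: 1) 1%g = a.
Proof. by rewrite tcoefZ -(hecke_one hH) tcoefT eqxx mulr1. Qed.

Lemma bar_leval d p :
  bar ((vpow d * leval (vpow (-1)) p) *: 1) = (vpow (- d) * leval (vpow 1) p) *: 1.
Proof.
have mulA1 (a b : laurent) : (a * b) *: (1 : H) = (a *: 1) * (b *: 1).
  by rewrite -scalerAl mul1r scalerA.
rewrite mulA1 rmorphM (bar_vpow hbar) [RHS]mulA1; congr (_ * _).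
elim/poly_ind: p => [|p c IHp]; first by rewrite !leval0 scale0r rmorph0.
rewrite !levalD !levalM !levalX !levalC !scalerDl rmorphD !mulA1 rmorphM IHp.
rewrite (bar_vpow hbar) opprK; congr (_ + _).
by rewrite !scaler_int rmorph_int.
Qed.

Lemma barcE a : bar (a *: 1) = barc a *: 1.
Proof.
have [d [p ->]] := ldeg_ex a.
by rewrite /barc !bar_leval tcoefA.
Qed.

Lemma barZ a h : bar (a *: h) = barc a *: bar h.
Proof. by rewrite -[a *: h]mulr_algl rmorphM /= barcE mulr_algl. Qed.

Lemma barcB a b : barc (a - b) = barc a - barc b.
Proof. by rewrite /barc scalerBl rmorphB tcoefB. Qed.

Lemma barcD a b : barc (a + b) = barc a + barc b.
Proof. by rewrite /barc scalerDl rmorphD tcoefD. Qed.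

Lemma barc_vpow d : barc (vpow d) = vpow (- d).
Proof. by rewrite /barc (bar_vpow hbar) tcoefA. Qed.

Lemma barc_nat n : barc n%:R = n%:R.
Proof. by rewrite /barc scaler_nat rmorph_nat -(scaler_nat n (1 : H)) tcoefA. Qed.

(** The uniqueness principle of Kazhdan-Lusztig theory: bar exchanges [v] and [v^-1], so no nonzero
    fixed coefficient has negative powers only. *)
Lemma barc_small_eq0 a : ldeg (-1) a -> barc a = a -> a = 0.
Proof.
move=> [p ->]; rewrite /barc bar_leval tcoefA opprK => Ep.
by rewrite (ldeg_sym0 (esym Ep)) leval0 mulr0.
Qed.

Lemma bar_klgen s : s \in S -> bar (klgen s) = klgen s.
Proof.
move=> sS.
have barT : bar (T s) = T s - qpar s *: 1.
  have [_ Tbar] := bar_T hbar s; rewrite (coxgenV hW sS) in Tbar.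
  have E : (T s - qpar s *: 1) * T s = 1.
    by rewrite mulrBl hecke_sqr // -scalerAl mul1r addrK.
  by rewrite -[LHS]mul1r -{1}E -mulrA Tbar mulr1.
rewrite /klgen rmorphD barZ rmorph1 barc_vpow opprK barT -addrA; congr (_ + _).
by rewrite -scaleNr -scalerDl /qpar opprB subrK.
Qed.

(** * The Kazhdan-Lusztig basis and its coordinates *)

Section KazhdanLusztig.
Variable C : gT -> H.
Hypothesis hC : kl_basis S T bar C.

Lemma bruhat_lt_len y w : bruhat_lt S y w -> (len y < len w)%N.
Proof.
case/andP=> ne /connectP[p yp Ew]; rewrite {}Ew in ne *.
have le x q : path [rel x z | ((x^-1 * z)%g \in reflections S)
    && (len x < len z)%N] x q -> (len x <= len (last x q))%N.
  elim: q x => //= z q IHq x /andP[/andP[_ /ltnW lxz] /IHq]; exact: leq_trans.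
case: p ne yp => [|z p] /=; first by rewrite eqxx.
by move=> _ /andP[/andP[_ lyz] /le]; apply: leq_trans.
Qed.

(** Trades the Bruhat order for length, on which the later inductions run; the witness is 0 when [z]
    is not Bruhat-below [w]. *)
Lemma tcoefC w z : exists2 p : laurent, ldeg (-1) p &
  tcoef (C w) z = if (len z < len w)%N then p else (z == w)%:R.
Proof.
have [_ [p psmall Cw]] := hC w; exists (if bruhat_lt S z w then p z else 0).
  by case: ifP => _; [exact/vneg_ldeg | exact: ldeg0].
have -> : tcoef (C w) z = (z == w)%:R + if bruhat_lt S z w then p z else 0.
  rewrite Cw tcoefD tcoefT; congr (_ + _); rewrite tcoef_bigsum.
  under eq_bigr => y _ do rewrite tcoefZ tcoefT.
  case: ifP => [lt|nlt].
    rewrite (bigD1 z) //= eqxx mulr1 big1 ?addr0 // => y /andP[_].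
    by rewrite eq_sym => /negPf->; rewrite mulr0.
  rewrite big1 // => y yw; case: eqP => [Ez|_]; last by rewrite mulr0.
  by rewrite Ez yw in nlt.
have [lt|nlt] := boolP (len z < len w)%N.
  by have [Ez|_] := eqVneq z w; [rewrite Ez ltnn in lt | rewrite add0r].
by case: ifP => [/bruhat_lt_len|]; rewrite ?addr0 // (negPf nlt).
Qed.

Lemma tcoefC_diag w : tcoef (C w) w = 1.
Proof. by have [p _ ->] := tcoefC w w; rewrite ltnn eqxx. Qed.

Lemma tcoefC_eq0 w z : z != w -> ~~ (len z < len w)%N -> tcoef (C w) z = 0.
Proof. by move=> /negPf ne /negPf nlt; have [p _ ->] := tcoefC w z; rewrite nlt ne. Qed.

Lemma tcoefC_small w z : z != w -> ldeg (-1) (tcoef (C w) z).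
Proof.
move=> ne; have [p p1 ->] := tcoefC w z.
by case: ifP => // _; rewrite (negPf ne); apply: ldeg0.
Qed.

Lemma tcoefC_deg w z : ldeg 0 (tcoef (C w) z).
Proof.
have [->|ne] := eqVneq z w; first by rewrite tcoefC_diag; apply: ldeg1.
exact: ldegW (tcoefC_small ne).
Qed.

(** Descending induction, well founded as lengths are bounded. It suits the comparison of
    coordinates because the [T]-expansion of [C w] only reaches downwards in length. *)
Lemma coxlen_ind_down (P : gT -> Prop) :
  (forall z, (forall u, (len z < len u)%N -> P u) -> P z) -> forall z, P z.
Proof.
move=> IH z; have [k] := ubnP (\max_u len u - len z)%N.
elim: k z => // k IHk z lt; apply: IH => u zu; apply: IHk.
by have := leq_bigmax (F := fun u => len u) u; lia.
Qed.

Lemma tcoef_sumC (a : gT -> laurent) z :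
  tcoef (\sum_w a w *: C w) z
  = a z + \sum_(w | (len z < len w)%N) a w * tcoef (C w) z.
Proof.
rewrite tcoef_bigsum (bigD1 z) //= tcoefZ tcoefC_diag mulr1; congr (_ + _).
rewrite (bigID (fun w => len z < len w)%N) /= addrC big1 ?add0r.
  apply: eq_big => w; last by rewrite tcoefZ.
  by apply: andb_idl; apply: contraTneq => ->; rewrite ltnn.
by move=> w /andP[ne nlt]; rewrite tcoefZ tcoefC_eq0 ?mulr0 // eq_sym.
Qed.

Lemma sumC_eq0 (a : gT -> laurent) : \sum_w a w *: C w = 0 -> forall z, a z = 0.
Proof.
move=> a0; apply: coxlen_ind_down => z IHz.
have := tcoef_sumC a z; rewrite a0 tcoef0 big1 ?addr0 // => w lt.
by rewrite IHz // mul0r.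
Qed.

Lemma spanC h : exists a : gT -> laurent, h = \sum_w a w *: C w.
Proof.
pose sp h := exists a : gT -> laurent, h = \sum_w a w *: C w.
have spD g1 g2 : sp g1 -> sp g2 -> sp (g1 + g2).
  move=> [a ->] [b ->]; exists (fun z => a z + b z).
  by rewrite -big_split; apply: eq_bigr => z _; rewrite scalerDl.
have spZ a g : sp g -> sp (a *: g).
  move=> [b ->]; exists (fun z => a * b z).
  by rewrite scaler_sumr; apply: eq_bigr => z _; rewrite scalerA.
have spsum (P : pred gT) (F : gT -> H) : (forall z, P z -> sp (F z)) -> sp (\sum_(z | P z) F z).
  move=> spF; apply: (big_ind sp) => //.
  by exists (fun=> 0); rewrite big1 // => z _; rewrite scale0r.
have spC w : sp (C w).
  exists (fun z => (z == w)%:R); rewrite (bigD1 w) //= eqxx scale1r big1 ?addr0 //.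
  by move=> z /negPf->; rewrite scale0r.
rewrite (tcoef_sum h); apply: (spsum) => w _; apply: (spZ).
have [k] := ubnP (len w); elim: k w => // k IHk w lw.
have [_ [p _ Cw]] := hC w.
have -> : T w = C w + (-1) *: \sum_(y | bruhat_lt S y w) p y *: T y.
  by rewrite Cw scaleN1r addrK.
apply: (spD) => //; apply: (spZ); apply: (spsum) => y yw; apply: (spZ); apply: (IHk).
by have := bruhat_lt_len yw; lia.
Qed.

Definition ccoef h : gT -> laurent := projT1 (cid (spanC h)).

Lemma ccoef_sum h : h = \sum_w ccoef h w *: C w.
Proof. by rewrite /ccoef; case: cid. Qed.

Lemma ccoef_uniq h (a : gT -> laurent) : h = \sum_w a w *: C w -> ccoef h =1 a.
Proof.
move=> Eh z; apply/eqP; rewrite -subr_eq0; apply/eqP.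
apply: (sumC_eq0 (a := fun z => ccoef h z - a z)).
under eq_bigr => w _ do rewrite scalerBl.
by rewrite sumrB -ccoef_sum -Eh subrr.
Qed.

Lemma ccoefD g h z : ccoef (g + h) z = ccoef g z + ccoef h z.
Proof.
apply: (ccoef_uniq (a := fun z => ccoef g z + ccoef h z)).
rewrite [in LHS](ccoef_sum g) [in LHS](ccoef_sum h) -big_split /=.
by apply: eq_bigr => w _; rewrite scalerDl.
Qed.

Lemma ccoefZ a h z : ccoef (a *: h) z = a * ccoef h z.
Proof.
apply: (ccoef_uniq (a := fun z => a * ccoef h z)).
rewrite [in LHS](ccoef_sum h) scaler_sumr.
by apply: eq_bigr => w _; rewrite scalerA.
Qed.

Lemma ccoefB g h z : ccoef (g - h) z = ccoef g z - ccoef h z.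
Proof. by rewrite -scaleN1r ccoefD ccoefZ mulN1r. Qed.

Lemma ccoef0 z : ccoef 0 z = 0.
Proof. by rewrite -(scale0r 0) ccoefZ mul0r. Qed.

Lemma ccoef_bigsum (I : Type) (r : seq I) (P : pred I) (F : I -> H) z :
  ccoef (\sum_(i <- r | P i) F i) z = \sum_(i <- r | P i) ccoef (F i) z.
Proof.
by apply: (big_morph (fun h => ccoef h z)) => [g h|]; [apply: ccoefD|apply: ccoef0].
Qed.

Lemma ccoefC w z : ccoef (C w) z = (z == w)%:R.
Proof.
apply: (ccoef_uniq (a := fun z => (z == w)%:R)).
rewrite (bigD1 w) //= eqxx scale1r big1 ?addr0 // => u /negPf->; exact: scale0r.
Qed.

Lemma ccoef_eq0 h : (forall z, ccoef h z = 0) -> h = 0.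
Proof. by move=> h0; rewrite (ccoef_sum h) big1 // => z _; rewrite h0 scale0r. Qed.

Lemma tcoef_ccoef h z :
  tcoef h z = ccoef h z + \sum_(w | (len z < len w)%N) ccoef h w * tcoef (C w) z.
Proof. by rewrite {1}(ccoef_sum h) tcoef_sumC. Qed.

(** No longer [C w] contributes at [z], so both kinds of coordinates coincide there. *)
Lemma tcoef_top h z : (forall u, (len z < len u)%N -> ccoef h u = 0) ->
  tcoef h z = ccoef h z /\ forall u, (len z < len u)%N -> tcoef h u = 0.
Proof.
move=> h0; split=> [|u zu]; rewrite tcoef_ccoef.
  by rewrite big1 ?addr0 // => u zu; rewrite h0 // mul0r.
by rewrite h0 // big1 ?addr0 // => x ux; rewrite h0 ?mul0r // (ltn_trans zu).
Qed.

Lemma ccoef_bar h z : bar h = h -> barc (ccoef h z) = ccoef h z.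
Proof.
move=> barh; apply/esym; move: z.
apply: (ccoef_uniq (a := fun z => barc (ccoef h z))).
rewrite -[LHS]barh {1}(ccoef_sum h) raddf_sum /=.
by apply: eq_bigr => w _; rewrite barZ; have [-> _] := hC w.
Qed.

Lemma ccoef_deg d h : (forall z, ldeg d (tcoef h z)) -> forall z, ldeg d (ccoef h z).
Proof.
move=> hd; apply: coxlen_ind_down => z IHz.
have -> : ccoef h z = tcoef h z - \sum_(w | (len z < len w)%N) ccoef h w * tcoef (C w) z.
  by rewrite tcoef_ccoef addrK.
apply: ldegB => //; apply: ldeg_sum => w lt.
by rewrite -[d]addr0; apply: ldegM; [apply: IHz | apply: tcoefC_deg].
Qed.

(** The deviation [h] of [C u * klgen r] from its expected value is fixed by bar and an eigenvector
    of [T r] for [- v^(- L r)]. A longest [C]-coordinate [z] of [h] is killed by the eigenvalue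
    equation if [z * r] is longer than [z], and by [barc_small_eq0] otherwise. *)
Lemma KL_mulT u r : r \in S -> (len (u * r)%g < len u)%N -> C u * T r = vpow (L r) *: C u.
Proof.
move=> rS ur; have Lr := hLpos rS.
set h := C u * klgen r - (vpow (L r) + vpow (- L r)) *: C u.
suff h0 : h = 0.
  have : C u * klgen r = (vpow (L r) + vpow (- L r)) *: C u by apply: subr0_eq.
  by rewrite mulrDr -scalerAr mulr1 scalerDl => /addIr.
have barh : bar h = h.
  rewrite rmorphB rmorphM bar_klgen // barZ; have [-> _] := hC u.
  by congr (_ - _ *: _); rewrite barcD !barc_vpow opprK addrC.
have klsq : klgen r * T r = vpow (L r) *: klgen r.
  rewrite mulrDl hecke_sqr // -scalerAl mul1r scalerDr scalerA -vpowD subrr vpow0.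
  by rewrite -addrA -scalerDl subrK scale1r addrC.
have hT : h * T r = - vpow (- L r) *: h.
  have CT : C u * T r = C u * klgen r - vpow (- L r) *: C u.
    by rewrite mulrDr -scalerAr mulr1 addrK.
  rewrite mulrBl -mulrA klsq -scalerAr -scalerAl CT /h.
  rewrite !scalerBr !scalerA opprB addrCA -scalerBl opprD addrA subrr sub0r.
  by rewrite addrC mulNr (scaleNr (_ * _)) opprK [X in X *: C u]mulrC.
apply: ccoef_eq0; apply: coxlen_ind_down => z IHz.
have [hz hlong] := tcoef_top IHz.
have [lt|ge] := boolP (len z < len (z * r)%g)%N.
  have := tcoef_mulT h (z * r)%g rS; rewrite (coxlen_mulSS hW) // hT tcoefZ hlong // mulr0.
  by rewrite mulr0 addr0 -hz.
apply: barc_small_eq0; last exact: ccoef_bar.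
(* What remains is the coefficient of [C u] at [z * r] minus [v^(- L r)] times the one at [z]. The
   former has negative degree: [z * r = u] would contradict that [r] is a descent of [u]. *)
rewrite -hz tcoefB tcoef_mul_klgen // (negPf ge) tcoefZ mulrDl opprD addrA addrK.
apply: ldegB.
  apply: tcoefC_small; apply: contraNneq ge => Eu.
  by move: ur; rewrite -Eu (coxlen_mulSS hW).
apply: (@ldegW (- L r + 0)); first by lia.
by apply: ldegM; [apply: ldeg_vpow | apply: tcoefC_deg].
Qed.

(** Comparing coefficients of [T z] in [KL_mulT], the one of [C u] at [z] is [v^(- L r)] times the
    one at [z * r]. *)
Lemma tcoefC_descent u r z : r \in S -> (len (u * r)%g < len u)%N ->
  (len z < len (z * r)%g)%N -> ldeg (- L r) (tcoef (C u) z).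
Proof.
move=> rS ur zr; have := tcoef_mulT (C u) z rS.
rewrite zr mul0r addr0 KL_mulT // tcoefZ => E.
have -> : tcoef (C u) z = vpow (- L r) * tcoef (C u) (z * r)%g.
  by rewrite -E mulrA -vpowD addNr vpow0 mul1r.
apply: (@ldegW (- L r + 0)); first by rewrite addr0.
by apply: ldegM; [apply: ldeg_vpow | apply: tcoefC_deg].
Qed.

(** * Admissible sets and the left ideals they span *)

Definition klspan (U : {set gT}) h := forall z, z \notin U -> ccoef h z = 0.

(* The last clause makes [C_u C_s] congruent to [C_us] modulo the span of [U]
   as soon as [L s < c]. *)
Definition admissible (U : {set gT}) (c : int) : Prop :=
  (forall g u, u \in U -> klspan U (g * C u)) /\
  (forall u z, u \in U -> z \notin U -> ldeg (- c) (tcoef (C u) z)).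

Lemma klspanB U g h : klspan U g -> klspan U h -> klspan U (g - h).
Proof. by move=> gU hU z zU; rewrite ccoefB gU // hU // subr0. Qed.

Lemma klspanZ U a h : klspan U h -> klspan U (a *: h).
Proof. by move=> hU z zU; rewrite ccoefZ hU // mulr0. Qed.

Lemma klspan_sum U (I : Type) (r : seq I) (P : pred I) (F : I -> H) :
  (forall i, P i -> klspan U (F i)) -> klspan U (\sum_(i <- r | P i) F i).
Proof. by move=> FU z zU; rewrite ccoef_bigsum big1 // => i /FU->. Qed.

Lemma klspanC (U : {set gT}) u : u \in U -> klspan U (C u).
Proof. by move=> uU z zU; rewrite ccoefC; case: eqP => // Ez; rewrite Ez uU in zU. Qed.

Lemma klspanS (U V : {set gT}) h : U \subset V -> klspan U h -> klspan V h.
Proof. by move=> /subsetP sUV hU z zV; apply: hU; apply: contra zV; apply: sUV. Qed.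

Lemma klspan_expand (U : {set gT}) h : klspan U h -> h = \sum_(u in U) ccoef h u *: C u.
Proof.
move=> hU; rewrite {1}(ccoef_sum h) (bigID (mem U)) /= [X in _ + X]big1 ?addr0 //.
by move=> z /hU->; rewrite scale0r.
Qed.

Lemma klspan_mull (U : {set gT}) g h : (forall g u, u \in U -> klspan U (g * C u)) ->
  klspan U h -> klspan U (g * h).
Proof.
move=> idU /klspan_expand->; rewrite mulr_sumr; apply: klspan_sum => u uU.
by rewrite -scalerAr; apply/klspanZ/idU.
Qed.

(** Removing from [g * C u] its part [h1] on [U] leaves [k], again an eigenvector of [T r] for
    [v^(L r)]. At a longest coordinate [z] of [k], the element [z * r] is longer, so [k] has no
    coefficient at [z * r], and hence none at [z]. *)
Lemma admissible_descent r : r \in S ->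
  admissible [set w | (len (w * r)%g < len w)%N] (L r).
Proof.
move=> rS; set U := [set w | _]; split=> [g u|u z]; rewrite !inE; last first.
  move=> ur zr; apply: tcoefC_descent => //.
  by rewrite ltn_neqAle eq_sym (coxlen_mulS_neq hW) // leqNgt.
move=> ur; set h := g * C u.
have hT : h * T r = vpow (L r) *: h by rewrite -mulrA KL_mulT // -scalerAr.
pose h1 := \sum_(z in U) ccoef h z *: C z.
have h1T : h1 * T r = vpow (L r) *: h1.
  rewrite mulr_suml scaler_sumr; apply: eq_bigr => z; rewrite inE => zr.
  by rewrite -scalerAl KL_mulT // !scalerA mulrC.
have h1U : klspan U h1 by apply: klspan_sum => z zU; apply/klspanZ/klspanC.
pose k := h - h1.
have kT : k * T r = vpow (L r) *: k by rewrite mulrBl hT h1T scalerBr.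
suff k0 : k = 0 by rewrite -(subrK h1 h) -/k k0 add0r.
have kU z : z \in U -> ccoef k z = 0.
  move=> zU; rewrite ccoefB /h1 ccoef_bigsum (bigD1 z) //= ccoefZ ccoefC eqxx mulr1.
  rewrite big1 ?addr0 ?subrr // => y /andP[_ ne].
  by rewrite ccoefZ ccoefC eq_sym (negPf ne) mulr0.
apply: ccoef_eq0; apply: coxlen_ind_down => z IHz.
have [zU|] := boolP (z \in U); first exact: kU.
rewrite inE => zr; have [<- klong] := tcoef_top IHz.
have {}zr : (len z < len (z * r)%g)%N.
  by rewrite ltn_neqAle eq_sym (coxlen_mulS_neq hW) // leqNgt.
have := tcoef_mulT k z rS; rewrite zr mul0r addr0 kT tcoefZ (klong _ zr).
move/(congr1 ( *%R (vpow (- L r)))).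
by rewrite mulrA -vpowD addNr vpow0 mul1r mulr0.
Qed.

(** * Enlarging and shrinking an admissible set by a generator *)

Section Step.
Variables (U : {set gT}) (c : int) (s : gT).
Hypotheses (Uc : admissible U c) (sS : s \in S) (sc : L s < c).

Let Us : {set gT} := [set w | (w * s)%g \in U].

Lemma ccoef_mul_klgen_deg u z : ldeg (L s) (ccoef (C u * klgen s) z).
Proof. by apply: ccoef_deg => y; apply: tcoef_klgen_deg => // x; apply: tcoefC_deg. Qed.

(** Outside [U] the product only shifts coordinates by [s]: the other term is at most [v^(L s)]
    times a coefficient of degree at most [- c]. *)
Lemma tcoef_mul_klgen_out u z : u \in U -> z \notin U ->
  ldeg (L s - c) (tcoef (C u * klgen s) z - tcoef (C u) (z * s)%g).
Proof.
move=> uU zU; rewrite tcoef_mul_klgen // [X in ldeg _ X]addrC addKr.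
apply: ldegM; last exact: Uc.2.
by apply: ldegW (ldeg_vpow _); case: ifP => _ //; have := hLpos sS; lia.
Qed.

(** The difference of the two sides is fixed by bar, so a negative degree suffices. In the
    descending induction, terms with [w] in [U] have degree at most [L s - c]; for [w] outside [U]
    the coordinate has degree at most 0 by induction and meets a coefficient of [C w] of negative
    degree. *)
Lemma ccoef_mul_klgen u z : u \in U -> z \notin U ->
  ccoef (C u * klgen s) z = (z == u * s)%g%:R.
Proof.
move=> uU; set h := C u * klgen s; move: z.
have barh : bar h = h by rewrite rmorphM bar_klgen //; have [-> _] := hC u.
suff small z : z \notin U -> ldeg (-1) (ccoef h z - (z == u * s)%g%:R).
  move=> z zU; apply/eqP; rewrite -subr_eq0; apply/eqP/barc_small_eq0; first exact: small.
  by rewrite barcB barc_nat ccoef_bar.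
move: z; apply: coxlen_ind_down => z IHz zU.
have tsmall : ldeg (-1) (tcoef h z - (z == u * s)%g%:R).
  rewrite -(subrK (tcoef (C u) (z * s)%g) (tcoef h z)) -addrA; apply: ldegD.
    by apply: ldegW (tcoef_mul_klgen_out uU zU); lia.
  have -> : (z == u * s)%g = (z * s == u)%g.
    by apply/eqP/eqP => [->|<-]; rewrite (coxlen_mulSS hW).
  have [->|ne] := eqVneq (z * s)%g u; first by rewrite tcoefC_diag subrr; apply: ldeg0.
  by rewrite subr0; apply: tcoefC_small.
have -> : ccoef h z = tcoef h z - \sum_(w | (len z < len w)%N) ccoef h w * tcoef (C w) z.
  by rewrite tcoef_ccoef addrK.
rewrite addrAC; apply: ldegB => //; apply: ldeg_sum => w zw.
have [wU|wU] := boolP (w \in U).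
  apply: (@ldegW (L s + - c)); first by lia.
  by apply: ldegM; [apply: ccoef_mul_klgen_deg | apply: Uc.2].
apply: (@ldegW (0 + -1)) => //; apply: ldegM; last first.
  by apply: tcoefC_small; apply: contraTneq zw => ->; rewrite ltnn.
rewrite -(subrK (w == u * s)%g%:R (ccoef h w)); apply: ldegD.
  exact: ldegW (IHz _ zw wU).
by case: eqP => _; [apply: ldeg1 | apply: ldeg0].
Qed.

Lemma klspan_mul_klgen h : klspan U h -> klspan (U :|: Us) (h * klgen s).
Proof.
move=> /klspan_expand->; rewrite mulr_suml; apply: klspan_sum => u uU.
rewrite -scalerAl; apply: klspanZ => z; rewrite inE negb_or => /andP[zU zUs].
rewrite ccoef_mul_klgen //; case: eqP => // Ez.
by rewrite inE Ez (coxlen_mulSS hW) // uU in zUs.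
Qed.

(* [C_us] is [C_u C_s] up to a remainder in the span of [U]. *)
Lemma klspan_rest w : (w * s)%g \in U -> w \notin U ->
  klspan U (C (w * s)%g * klgen s - C w).
Proof.
move=> wsU wU z zU; rewrite ccoefB ccoef_mul_klgen // ccoefC.
by rewrite (coxlen_mulSS hW) // subrr.
Qed.

(** For [w] in [Us] but not in [U], [C w] is [C (w * s) * klgen s] minus an element of the span of
    [U]; ideal property and degree bound pass through this identity, the factor [klgen s] costing
    [L s] in level. *)
Lemma admissible_setU : admissible (U :|: Us) (c - L s).
Proof.
have cs : - c <= - (c - L s) by have := hLpos sS; lia.
split=> [g w|w z].
  rewrite !inE; case/orP=> [wU|wsU].
    by apply: klspanS (Uc.1 g w wU); apply: subsetUl.
  have [wU|wU] := boolP (w \in U).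
    by apply: klspanS (Uc.1 g w wU); apply: subsetUl.
  rewrite -[C w](subKr (C (w * s)%g * klgen s)) mulrBr mulrA; apply: klspanB.
    by apply: klspan_mul_klgen; apply: Uc.1.
  apply: klspanS (subsetUl _ _) _; apply: klspan_mull Uc.1 _.
  exact: klspan_rest.
rewrite !inE negb_or => wUs /andP[zU zsU].
have [wU|wU] := boolP (w \in U); first exact: ldegW cs (Uc.2 _ _ wU zU).
move: wUs; rewrite (negPf wU) /= => wsU.
set k := C (w * s)%g * klgen s - C w.
have -> : C w = C (w * s)%g * klgen s - k by rewrite subKr.
rewrite tcoefB; apply: ldegB.
  rewrite -(subrK (tcoef (C (w * s)%g) (z * s)%g) (tcoef _ z)); apply: ldegD.
    by apply: ldegW (tcoef_mul_klgen_out wsU zU); lia.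
  exact: ldegW cs (Uc.2 _ _ wsU zsU).
rewrite /k (klspan_expand (klspan_rest wsU wU)) tcoef_bigsum; apply: ldeg_sum => u uU.
rewrite tcoefZ; apply: (@ldegW (L s + - c)); first by lia.
apply: ldegM; last exact: Uc.2.
rewrite ccoefB ccoefC; apply: ldegB; first exact: ccoef_mul_klgen_deg.
have := hLpos sS => Ls.
case: eqP => _; last exact: ldeg0.
by apply: ldegW ldeg1; lia.
Qed.

(** If [z * s] lies outside [U], the [C]-coordinate of [h * klgen s] at [z * s] is that of [h] at
    [z]. *)
Lemma klspan_setI h : klspan U h -> klspan U (h * klgen s) -> klspan (U :&: Us) h.
Proof.
move=> hU hsU z; rewrite !inE negb_and; have [zU /= zsU|zU _] := boolP (z \in U); last exact: hU.
have := hsU _ zsU; rewrite (klspan_expand hU) mulr_suml !ccoef_bigsum.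
rewrite (bigD1 z) //= [X in _ -> X = 0](bigD1 z) //= -scalerAl !ccoefZ.
rewrite ccoef_mul_klgen // eqxx ccoefC eqxx big1 ?addr0 => [->|u /andP[uU ne]].
  rewrite add0r big1 // => u /andP[_ ne].
  by rewrite ccoefZ ccoefC eq_sym (negPf ne) mulr0.
rewrite -scalerAl ccoefZ ccoef_mul_klgen // (inj_eq (mulIg s)) eq_sym (negPf ne).
by rewrite mulr0.
Qed.

Lemma klspan_mulC_setI w : w \in U -> (w * s)%g \in U -> klspan U (C w * klgen s).
Proof.
move=> wU wsU z zU; rewrite ccoef_mul_klgen //; case: eqP => // Ez.
by rewrite Ez wsU in zU.
Qed.

Lemma admissible_setI : admissible (U :&: Us) (c - L s).
Proof.
have cs : - c <= - (c - L s) by have := hLpos sS; lia.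
split=> [g w|w z]; rewrite !inE => /andP[wU wsU].
  apply: klspan_setI; first exact: Uc.1.
  by rewrite -mulrA; apply: klspan_mull Uc.1 _; apply: klspan_mulC_setI.
have [zU /= zsU|zU _] := boolP (z \in U); last exact: ldegW cs (Uc.2 _ _ wU zU).
(* With [z * s] outside [U], the coefficient of [C w] at [z] is, up to degree [L s - c], that of
   [C w * klgen s] at [z * s]. This product lies in the span of [U], whose basis elements have small
   coefficients outside [U]. *)
have := tcoef_mul_klgen_out wU zsU; rewrite (coxlen_mulSS hW) // => d1.
have -> : tcoef (C w) z = tcoef (C w * klgen s) (z * s)%g
    - (tcoef (C w * klgen s) (z * s)%g - tcoef (C w) z) by rewrite subKr.
apply: ldegB; last by apply: ldegW d1; lia.
rewrite (klspan_expand (klspan_mulC_setI wU wsU)) tcoef_bigsum.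
apply: ldeg_sum => u uU; rewrite tcoefZ; apply: (@ldegW (L s + - c)); first by lia.
by apply: ldegM; [apply: ccoef_mul_klgen_deg | apply: Uc.2].
Qed.

End Step.

(** * Left cells and extended descents *)

Lemma left_le_admissible U c y w : admissible U c ->
  left_le S C y w -> w \in U -> y \in U.
Proof.
move=> [idU _] /connectP[p yp ->]; elim: p y yp => //= x p IHp y /andP[/asboolP yx xp].
move=> /(IHp x xp) xU; have [s sS [a Ea ay]] := yx.
apply: contraNT ay => yU; rewrite -(ccoef_uniq Ea).
by rewrite (idU (C s) x xU y yU).
Qed.

Lemma left_sim_admissible U c y w : admissible U c -> left_sim S C y w ->
  (y \in U) = (w \in U).
Proof.
move=> Uc /andP[yw wy]; apply/idP/idP; exact: left_le_admissible Uc _.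
Qed.

(* Once [y] and [w] are known to agree on [U], one of the steps [U :|: U s] and
   [U :&: U s] detects whether [y s] and [w s] lie in [U]. *)
Lemma left_sim_shift y w : left_sim S C y w -> forall (rs : seq gT) U c,
    {subset rs <= S} -> admissible U c -> \sum_(x <- rs) L x < c ->
  (y * \prod_(x <- rs) x \in U)%g = (w * \prod_(x <- rs) x \in U)%g.
Proof.
move=> yw; elim/last_ind => [|rs s IHrs] U c rsS Uc.
  by rewrite !big_nil !mulg1 => _; apply: left_sim_admissible Uc yw.
have sS : s \in S by apply: rsS; rewrite mem_rcons mem_head.
have {}rsS : {subset rs <= S} by move=> x xrs; apply: rsS; rewrite mem_rcons inE xrs orbT.
rewrite !big_rcons /= !mulgA => lt.
have L0 : 0 <= \sum_(x <- rs) L x.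
  by rewrite big_seq sumr_ge0 // => x /rsS /hLpos /ltW.
have sc : L s < c by apply: le_lt_trans lt; rewrite lerDr.
have E : (y * \prod_(x <- rs) x \in U)%g = (w * \prod_(x <- rs) x \in U)%g.
  by apply: IHrs Uc _ => //; apply: le_lt_trans lt; rewrite lerDl ltW // hLpos.
have lt' : \sum_(x <- rs) L x < c - L s by rewrite ltrBrDr.
have := IHrs _ _ rsS (admissible_setU Uc sS sc) lt'.
have := IHrs _ _ rsS (admissible_setI Uc sS sc) lt'.
(* Inside [U] the intersection decides; outside [U] the union does. *)
by rewrite !inE E; case: (_ \in U).
Qed.

End KazhdanLusztig.

End Bar.
End Hecke.

Theorem corollary4p6 (gT : finGroupType) (S : {set gT}) (L : gT -> int)
    (hW : coxeter_system S)
    (hL : weight_function S L)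
    (hLpos : forall s : gT, s \in S -> 0 < L s)
    (H : algType laurent) (T : gT -> H) (hH : hecke_algebra S L T)
    (bar : {rmorphism H -> H}) (hbar : bar_involution T bar)
    (C : gT -> H) (hC : kl_basis S T bar C)
    (y w : gT) (hyw : left_sim S C y w) :
  ext_right_descents S L y = ext_right_descents S L w.
Proof.
suff main sigma : sigma \in ext_gens S L ->
    (coxlen S (y * sigma)%g < coxlen S y)%N = (coxlen S (w * sigma)%g < coxlen S w)%N.
  apply/setP => sigma; rewrite /ext_right_descents in_set [RHS]in_set.
  by apply: andb_id2l; apply: main.
have shift rs r : {subset rs <= S} -> r \in S -> \sum_(x <- rs) L x < L r ->
    (coxlen S (y * \prod_(x <- rs) x * r)%g < coxlen S (y * \prod_(x <- rs) x)%g)%N =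
    (coxlen S (w * \prod_(x <- rs) x * r)%g < coxlen S (w * \prod_(x <- rs) x)%g)%N.
  move=> rsS rS lt.
  have := left_sim_shift hW hLpos hbar hyw rsS
    (admissible_descent hW hLpos hH hbar hC rS) lt.
  by rewrite !inE.
rewrite inE => /orP[sS|]; last rewrite inE => /asboolP[r [rs [[rs0 rS rsS rsL _] ->]]].
  have := shift [::] sigma; rewrite !big_nil !mulg1; apply => //.
  exact: hLpos.
(* The shift runs along [r_k, ..., r_1], so that [sigma] becomes [d * r * d^-1] with [d] the product
   over [rev rs]. *)
have rrS : {subset rev rs <= S} by move=> x; rewrite mem_rev; apply: rsS.
have sumlt : \sum_(x <- rev rs) L x < L r.
  by rewrite (perm_big rs) ?perm_rev //=; apply: sum_lt_size.
have dV : (\prod_(x <- rs) x = (\prod_(x <- rev rs) x)^-1)%g.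
  elim: rs rsS {rs0 rsL rrS sumlt} => [|x rs IHrs] rsS; first by rewrite !big_nil invg1.
  rewrite rev_cons big_rcons big_cons /= invMg (coxgenV hW) ?rsS ?mem_head // IHrs //.
  by move=> z zrs; apply: rsS; rewrite inE zrs orbT.
rewrite dV !(coxlen_conj hW) ?shift //; exact: (weight_lt_ndescent hW hL hLpos).
Qed.
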